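(* Let $\Gamma$ be a connected graph with diameter two. Then $$\mathrm{sdim}(\Gamma)=|V(\Gamma)|-\omega(\mathcal{R}_\Gamma).$$
   Context: $V(\Gamma)$ denotes the vertex set of a graph $\Gamma$. The distance between two vertices of a connected graph is the length of a shortest path between them, and the diameter of $\Gamma$ is the greatest distance between any two vertices. The closed neighborhood $N_\Gamma[x]$ of a vertex $x$ is the set of vertices at distance at most one from $x$. A subset of $V(\Gamma)$ is a clique if any two distinct vertices in it are adjacent in $\Gamma$; the clique number $\omega(\Gamma)$ is the maximum cardinality of a clique in $\Gamma$. For $x,y,z\in V(\Gamma)$, the vertex $z$ strongly resolves $x$ and $y$ if there exists a shortest path from $z$ to $x$ containing $y$, or a shortest path from $z$ to $y$ containing $x$. A subset $S$ of $V(\Gamma)$ is a strong resolving set of $\Gamma$ if every pair of vertices of $\Gamma$ is strongly resolved by some vertex of $S$. The strong metric dimension $\mathrm{sdim}(\Gamma)$ is the smallest cardinality of a strong resolving set of $\Gamma$. Reduced graph: for vertices $x,y$ of $\Gamma$ define $x\equiv y$ if $N_\Gamma[x]=N_\Gamma[y]$; this is an equivalence relation on $V(\Gamma)$. Let $U(\Gamma)$ be a complete set of distinct representatives for this equivalence relation. The reduced graph $\mathcal{R}_\Gamma$ of $\Gamma$ has vertex set $U(\Gamma)$, and two vertices are adjacent in $\mathcal{R}_\Gamma$ if they are adjacent in $\Gamma$. *)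

(* Defs.v *)
From mathcomp Require Import all_boot.

Set Implicit Arguments.
Unset Strict Implicit.
Unset Printing Implicit Defensive.

Record sgraph := SGraph {
  vertex :> finType;
  adj : rel vertex;
  adj_sym : symmetric adj;
  adj_irrefl : irreflexive adj }.

Arguments adj {s} x y : rename.

Section Distance.
Variable G : sgraph.
Implicit Types (x y z : G) (p : seq G).

Definition connected : bool := [forall x : G, forall y : G, connect adj x y].

(* The vertex sequence of the path is x :: p, so its length is size p. *)
Definition gpath x y p : bool :=
  [&& path adj x p, last x p == y & uniq (x :: p)].

(* A path has at most #|G| vertices, so the search below finds the length of
   a shortest one; the value is #|G| when no path joins x to y. *)
Definition dist x y : nat :=
  find (fun n => [exists p : n.-tuple G, gpath x y p]) (iota 0 #|G|).

Definition diameter : nat := \max_(x : G) \max_(y : G) dist x y.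

Definition shortest_path x y p : bool :=
  gpath x y p && (size p == dist x y).

Definition cl_nbhd x : {set G} := [set y | dist x y <= 1].

End Distance.

Section StrongMetricDimension.
Variable G : sgraph.
Implicit Types (x y z : G) (S : {set G}).

Definition strongly_resolves z x y : bool :=
  [exists p : (dist z x).-tuple G, shortest_path z x p && (y \in z :: p)]
  || [exists p : (dist z y).-tuple G, shortest_path z y p && (x \in z :: p)].

Definition strong_resolving_set S : bool :=
  [forall x : G, forall y : G,
    (x != y) ==> [exists z in S, strongly_resolves z x y]].

(* In a connected graph the full vertex set is strongly resolving, so this
   minimum is taken over a nonempty family. *)
Definition sdim : nat :=
  #|[arg min_(S < [set: G] | strong_resolving_set S) #|S|]|.

End StrongMetricDimension.

Definition clique (G : sgraph) (K : {set G}) : bool :=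
  [forall x in K, forall y in K, (x != y) ==> adj x y].

Definition clique_number (G : sgraph) : nat :=
  \max_(K : {set G} | clique K) #|K|.

Section ReducedGraph.
Variable G : sgraph.

Definition twin : rel G := [rel x y | cl_nbhd x == cl_nbhd y].

Definition twin_representatives (U : {set G}) : bool :=
  is_transversal U (equivalence_partition twin [set: G]) [set: G].

Variable U : {set G}.

Definition reduced_adj : rel {x : G | x \in U} :=
  [rel u v | adj (val u) (val v)].

Lemma reduced_adj_sym : symmetric reduced_adj.
Proof. by move=> u v; exact: adj_sym. Qed.

Lemma reduced_adj_irrefl : irreflexive reduced_adj.
Proof. by move=> u; exact: adj_irrefl. Qed.

Definition reduced_graph : sgraph :=
  SGraph reduced_adj_sym reduced_adj_irrefl.

End ReducedGraph.

(* Main.v *)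
Require Import Defs.
From mathcomp Require Import all_boot.

Set Implicit Arguments.
Unset Strict Implicit.
Unset Printing Implicit Defensive.

(** Strong resolution is the equality case of the triangle inequality: [z]
    strongly resolves [x] and [y] iff [y] lies metrically between [z] and [x],
    or [x] between [z] and [y] ([strongly_resolvesE]).  When all distances are
    at most two and [x], [y], [z] are distinct, the first case can only read
    [2 = 1 + 1]: [x] and [y] are adjacent, and [z] lies in [N[y]] but not in
    [N[x]].  Two vertices outside a strong resolving set [S] are therefore
    adjacent and not twins, so the complement of [S] is a clique without twins.
    Conversely, if the complement of [S] is such a clique, two vertices outside
    [S] are separated by some [z] adjacent to exactly one of them; this [z]
    misses a vertex of the clique, so it lies in [S], and it resolves the pair.
    A pair meeting [S] resolves itself.  Hence strong resolving sets are exactly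
    the complements of twin-free cliques ([strong_resolving_setE]).

    It remains to see that the largest twin-free cliques have [omega] of the
    reduced graph as their size.  A clique of the reduced graph is a twin-free
    clique of the graph.  In the other direction, replacing each vertex of a
    twin-free clique by the representative of its twin class is injective and
    preserves adjacency, since adjacency of non-twins depends only on their twin
    classes ([adj_twin]). *)

(** * Distances and shortest paths *)

Section DistanceTheory.
Variable G : sgraph.
Implicit Types (x y z : G) (p s : seq G).

Lemma uniq_leq_card s : uniq s -> size s <= #|G|.
Proof. by move/card_uniqP <-; apply: max_card. Qed.

(** Removing the loops of a walk makes it no longer, and a loop-free one is
    among the paths that the search defining [dist] inspects. *)
Lemma dist_walk x p : path adj x p -> dist x (last x p) <= size p.
Proof.
move=> xp; case: (shortenP xp) => p' xp' Up' sub_p'.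
have le_p'p : size p' <= size p.
  by apply: uniq_leq_size => //; case/andP: Up'.
apply: leq_trans le_p'p.
have lt_p' : size p' < #|G| by exact: (uniq_leq_card Up').
rewrite leqNgt; apply/negP => /(before_find 0).
rewrite nth_iota // add0n => /negbT/negP[].
by apply/existsP; exists (in_tuple p'); rewrite /gpath xp' eqxx Up'.
Qed.

(** A repeated vertex could be cut out, giving a walk shorter than the
    distance; so a walk of minimal length is automatically a path. *)
Lemma walk_shortest x p :
  path adj x p -> size p <= dist x (last x p) -> shortest_path x (last x p) p.
Proof.
move=> xp le_p; rewrite /shortest_path /gpath xp eqxx eqn_leq le_p dist_walk //.
rewrite !andbT; case: (shortenP xp) le_p => p' xp' Up' sub_p' le_p.
apply: (leq_size_uniq Up').
- move=> w; rewrite !inE => /orP[-> // | /sub_p' ->]; exact: orbT.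
- by rewrite /= ltnS (leq_trans le_p) ?dist_walk.
Qed.

Lemma dist_diameter x y : dist x y <= diameter G.
Proof.
apply: leq_trans (leq_bigmax (F := fun x => \max_y dist x y) x).
exact: (leq_bigmax (F := dist x) y).
Qed.

Hypothesis Gconn : connected G.

Lemma dist_attained x y :
  exists p, [/\ path adj x p, last x p = y & size p = dist x y].
Proof.
have /connectP[p xp ->] := forallP (forallP Gconn x) y.
case: (shortenP xp) => p' xp' Up' _; set y' := last x p'.
have lt_p' : size p' < #|G| by exact: (uniq_leq_card Up').
have has_n : has (fun n => [exists q : n.-tuple G, gpath x y' q]) (iota 0 #|G|).
  apply/hasP; exists (size p'); first by rewrite mem_iota.
  by apply/existsP; exists (in_tuple p'); rewrite /gpath xp' eqxx Up'.
have := nth_find 0 has_n; rewrite nth_iota; last first.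
  by rewrite has_find size_iota in has_n.
by case/existsP=> q /and3P[xq /eqP lq _]; exists q; rewrite size_tuple.
Qed.

Lemma dist0 x : dist x x = 0.
Proof. by apply/eqP; rewrite -leqn0; apply: (@dist_walk x [::]). Qed.

Lemma dist_gt0 x y : x != y -> 0 < dist x y.
Proof.
have [[|z p] [_ <- <-] //] := dist_attained x y.
by rewrite eqxx.
Qed.

Lemma dist_le1 x y : (dist x y <= 1) = (x == y) || adj x y.
Proof.
apply/idP/orP => [|[/eqP-> | xy]].
- have [[|z [|t p]] [/= xp <- <-] //] := dist_attained x y; first by left.
  by right; case/andP: xp.
- by rewrite dist0.
- by apply: (@dist_walk x [:: y]); rewrite /= xy.
Qed.

Lemma dist_eq1 x y : (dist x y == 1) = adj x y.
Proof.
have [<- | neq_xy] := eqVneq x y; first by rewrite dist0 adj_irrefl.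
by rewrite eqn_leq dist_gt0 // andbT dist_le1 (negPf neq_xy).
Qed.

(** A vertex on a shortest path cuts it into two walks, and conversely two
    shortest paths concatenate to a walk as short as the right-hand side
    allows.  The right-hand side is one half of an equality whose other half
    is the triangle inequality. *)
Lemma shortest_path_throughE z x y :
  [exists p : (dist z x).-tuple G, shortest_path z x p && (y \in z :: p)]
    = (dist z y + dist y x <= dist z x).
Proof.
apply/existsP/idP => [[p /andP[/andP[/and3P[zp /eqP lp _] /eqP sz_p] yp]] | le].
- rewrite -sz_p; move: zp lp; case/splitPl: yp => p1 p2 lp1.
  rewrite cat_path last_cat size_cat lp1 => /andP[zp1 yp2] lp2.
  by rewrite leq_add // -?lp2 -?lp1 dist_walk // lp1.
- have [p [zp lp sz_p]] := dist_attained z y.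
  have [q [yq lq sz_q]] := dist_attained y x.
  have zpq : path adj z (p ++ q) by rewrite cat_path zp lp.
  have lpq : last z (p ++ q) = x by rewrite last_cat lp.
  have sz_pq : size (p ++ q) == dist z x.
    by rewrite eqn_leq {1}size_cat sz_p sz_q le -lpq dist_walk.
  exists (Tuple sz_pq); rewrite /= -{1}lpq walk_shortest //; last first.
    by rewrite lpq (eqP sz_pq).
  by rewrite -cat_cons mem_cat -lp mem_last.
Qed.

Lemma strongly_resolvesE z x y :
  strongly_resolves z x y =
    (dist z y + dist y x <= dist z x) || (dist z x + dist x y <= dist z y).
Proof. by rewrite /strongly_resolves !shortest_path_throughE. Qed.

(** * Twins *)

Lemma mem_cl_nbhd x y : (y \in cl_nbhd x) = (x == y) || adj x y.
Proof. by rewrite inE dist_le1. Qed.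

Lemma cl_nbhd_sym x y : (y \in cl_nbhd x) = (x \in cl_nbhd y).
Proof. by rewrite !mem_cl_nbhd eq_sym adj_sym. Qed.

(** Being adjacent or equal to [x] depends on [N[x]] only, and symmetrically
    for [y], so both ends may move within their twin classes. *)
Lemma adj_twin x y u v :
  twin x u -> twin y v -> u != v -> adj x y -> adj u v.
Proof.
move=> /eqP xu /eqP yv neq_uv xy.
have : v \in cl_nbhd u.
  by rewrite -xu cl_nbhd_sym -yv mem_cl_nbhd adj_sym xy orbT.
by rewrite mem_cl_nbhd (negPf neq_uv).
Qed.

End DistanceTheory.

(** * Twin-free cliques and strong resolving sets *)

Definition twin_free_clique (G : sgraph) (K : {set G}) : bool :=
  [forall x in K, forall y in K, (x != y) ==> adj x y && ~~ twin x y].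

Lemma twin_free_cliqueP (G : sgraph) (K : {set G}) :
  reflect {in K &, forall x y, x != y -> adj x y /\ ~~ twin x y}
          (twin_free_clique K).
Proof.
apply: (iffP forall_inP) => [tfK x y xK yK neq_xy | tfK x xK].
  by apply/andP; move: (forall_inP (tfK x xK) y yK); rewrite neq_xy.
by apply/forall_inP => y yK; apply/implyP => /(tfK x y xK yK)[-> ->].
Qed.

Lemma cliqueP (G : sgraph) (K : {set G}) :
  reflect {in K &, forall x y, x != y -> adj x y} (clique K).
Proof.
apply: (iffP forall_inP) => [clK x y xK yK | clK x xK].
  exact: implyP (forall_inP (clK x xK) y yK).
by apply/forall_inP => y yK; apply/implyP; apply: clK.
Qed.

Section DiameterTwo.
Variable G : sgraph.
Hypotheses (Gconn : connected G) (Gdiam : diameter G <= 2).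
Implicit Types (x y z : G) (S : {set G}).

Lemma dist_le2 x y : dist x y <= 2.
Proof. exact: leq_trans (dist_diameter x y) Gdiam. Qed.

(** With distances bounded by two, a third vertex can only be an end of a
    geodesic through the pair in the form [z - y - x], and then [z] tells the
    closed neighbourhoods of [x] and [y] apart. *)
Lemma between_adj_not_twin x y z :
    x != y -> z != y -> dist z y + dist y x <= dist z x ->
  adj x y /\ ~~ twin x y.
Proof.
move=> neq_xy neq_zy le_d.
have zy_gt0 := dist_gt0 Gconn neq_zy.
have yx_gt0 : 0 < dist y x by rewrite (dist_gt0 Gconn) // eq_sym.
have le_d2 : dist z y + dist y x <= 2 := leq_trans le_d (dist_le2 z x).
have zy1 : dist z y <= 1.
  by rewrite -(leq_add2r 1) (leq_trans _ le_d2) ?leq_add2l.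
have yx1 : dist y x == 1.
  by rewrite eqn_leq yx_gt0 -(leq_add2l 1) (leq_trans _ le_d2) ?leq_add2r.
split; first by rewrite adj_sym -(dist_eq1 Gconn).
apply/eqP => eq_xy; have : z \in cl_nbhd x.
  by rewrite eq_xy (cl_nbhd_sym Gconn) inE.
rewrite (cl_nbhd_sym Gconn) inE leqNgt => /negP[].
by apply: leq_trans le_d; rewrite (eqP yx1) addn1 ltnS.
Qed.

Lemma dist_adj_nonadj x y z :
  adj x y -> z \in cl_nbhd x -> z \notin cl_nbhd y ->
  dist z x + dist x y <= dist z y.
Proof.
move=> xy zx zNy.
have -> : dist x y = 1 by apply/eqP; rewrite (dist_eq1 Gconn).
rewrite addn1; apply: (@leq_ltn_trans 1).
  by rewrite (cl_nbhd_sym Gconn) inE in zx.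
by rewrite ltnNge; rewrite (cl_nbhd_sym Gconn) inE in zNy.
Qed.

Lemma strong_resolving_setE S :
  strong_resolving_set S = twin_free_clique (~: S).
Proof.
apply/idP/twin_free_cliqueP => [resS x y | tfS].
- rewrite !inE => xS yS neq_xy.
  have /implyP/(_ neq_xy) := forallP (forallP resS x) y.
  case/exists_inP=> z zS.
  have neq_zx : z != x by apply: contraNneq xS => <-.
  have neq_zy : z != y by apply: contraNneq yS => <-.
  rewrite strongly_resolvesE // => /orP[|le_d].
    exact: between_adj_not_twin.
  rewrite adj_sym /twin /= eq_sym.
  by apply: (between_adj_not_twin (z := z)) => //; rewrite eq_sym.
- apply/forallP => x; apply/forallP => y; apply/implyP => neq_xy.
  have [xS | xNS] := boolP (x \in S).
    (* A vertex of [S] resolves every pair that contains it. *)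
    by apply/exists_inP; exists x;
      rewrite // strongly_resolvesE // dist0 leqnn orbT.
  have [yS | yNS] := boolP (y \in S).
    by apply/exists_inP; exists y; rewrite // strongly_resolvesE // dist0 leqnn.
  (* A vertex outside [S] would be in the closed neighbourhood of every vertex
     of the clique, so one that misses a clique vertex belongs to [S]. *)
  have inS w z : w \notin S -> z \notin cl_nbhd w -> z \in S.
    move=> wNS; apply: contraNT => zNS; rewrite mem_cl_nbhd //.
    have [// | neq_wz] := eqVneq w z.
    by case: (tfS w z) => //; rewrite inE.
  have [|| xy Ntw] := tfS x y _ _ neq_xy; rewrite ?inE //.
  move: Ntw; rewrite /twin /= eqEsubset negb_and.
  case/orP => /subsetPn[z z_in z_out]; apply/exists_inP; exists z;
    rewrite ?strongly_resolvesE //; try exact: inS z_out; apply/orP.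
  + by right; apply: dist_adj_nonadj.
  + by left; apply: dist_adj_nonadj; rewrite // adj_sym.
Qed.

End DiameterTwo.

(** * Cliques of the reduced graph *)

Section Reduced.
Variables (G : sgraph) (U : {set G}).
Hypotheses (Gconn : connected G) (Urepr : twin_representatives U).

Lemma twin_equiv : {in [set: G] & &, equivalence_rel (@twin G)}.
Proof.
by move=> x y z _ _ _; split=> [|/eqP xy]; rewrite /twin /= ?eqxx // xy.
Qed.

Lemma mem_twin_class (x y : G) :
  (y \in pblock (equivalence_partition (@twin G) [set: G]) x) = twin x y.
Proof. by rewrite (pblock_equivalence_partition twin_equiv) ?inE. Qed.

Let twin_partition := equivalence_partitionP twin_equiv.

Let in_twin_classes (x : G) :
  pblock (equivalence_partition (@twin G) [set: G]) x
    \in equivalence_partition (@twin G) [set: G].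
Proof. by rewrite pblock_mem // (cover_partition twin_partition) inE. Qed.

Definition twin_rep (x : G) : G :=
  transversal_repr x U (pblock (equivalence_partition (@twin G) [set: G]) x).

Lemma twin_rep_in x : twin_rep x \in U.
Proof. exact: repr_mem_transversal Urepr _ _ (in_twin_classes x). Qed.

Lemma twin_twin_rep x : twin x (twin_rep x).
Proof.
rewrite -mem_twin_class.
exact: repr_mem_pblock Urepr _ _ (in_twin_classes x).
Qed.

Lemma twin_representatives_inj : {in U &, forall x y, twin x y -> x = y}.
Proof.
move=> x y xU yU tw; apply: (pblock_inj Urepr) => //; apply/eqP.
have /and3P[/eqP cov tI _] := twin_partition.
by rewrite eq_pblock // ?cov ?inE // mem_twin_class.
Qed.

Lemma twin_free_clique_val (K : {set reduced_graph U}) :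
  clique K -> twin_free_clique (val @: K).
Proof.
move=> /cliqueP clK; apply/twin_free_cliqueP => x y /imsetP[u uK ->] {x}.
case/imsetP=> v vK -> {y} neq_uv; split; last first.
  by apply: contra neq_uv => /(twin_representatives_inj (valP u) (valP v)) ->.
by apply: (clK u v) => //; apply: contraNneq neq_uv => ->.
Qed.

Definition reduced_rep (x : G) : reduced_graph U :=
  Sub (twin_rep x) (twin_rep_in x).

Lemma reduced_rep_twin x y : reduced_rep x = reduced_rep y -> twin x y.
Proof.
move=> /(congr1 val) /= eq_rep; have := twin_twin_rep x.
by rewrite /twin /= eq_rep (eqP (twin_twin_rep y)).
Qed.

Lemma clique_reduced_rep (K : {set G}) :
  twin_free_clique K -> clique (reduced_rep @: K).
Proof.
move=> /twin_free_cliqueP tfK; apply/cliqueP => u v /imsetP[x xK ->] {u}.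
case/imsetP=> y yK -> {v} neq_rep.
have [|xy _] := tfK x y xK yK; first by apply: contraNneq neq_rep => ->.
by apply: adj_twin (twin_twin_rep x) (twin_twin_rep y) _ xy.
Qed.

(** Cliques of the reduced graph embed as twin-free cliques, and twin-free
    cliques are sent injectively to cliques of the reduced graph: distinct
    members have distinct twin classes, hence distinct representatives. *)
Lemma clique_number_reduced :
  clique_number (reduced_graph U)
    = \max_(K : {set G} | twin_free_clique K) #|K|.
Proof.
apply/eqP; rewrite eqn_leq; apply/andP; split; apply/bigmax_leqP => K clK.
- rewrite -(card_imset _ val_inj).
  exact: (leq_bigmax_cond (F := fun K : {set G} => #|K|)
            _ (twin_free_clique_val clK)).
- have inj_rep : {in K &, injective reduced_rep}.
    move=> x y xK yK /reduced_rep_twin tw; apply/eqP; apply: contraT.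
    by move=> /(twin_free_cliqueP _ clK x y xK yK)[_]; rewrite tw.
  rewrite -(card_in_imset inj_rep).
  exact: (leq_bigmax_cond (F := fun K : {set reduced_graph U} => #|K|)
            _ (clique_reduced_rep clK)).
Qed.

End Reduced.

Theorem theorem2p2 (G : sgraph) (U : {set G})
    (Gconn : connected G) (Gdiam : diameter G = 2)
    (Urepr : twin_representatives U) :
  sdim G = #|G| - clique_number (reduced_graph U).
Proof.
rewrite (clique_number_reduced Gconn Urepr) /sdim.
have resE (S : {set G}) : strong_resolving_set S = twin_free_clique (~: S).
  by rewrite (strong_resolving_setE Gconn) ?Gdiam.
case: arg_minnP => [|S resS minS].
  by rewrite resE setCT; apply/twin_free_cliqueP => x y; rewrite inE.
rewrite -(cardsC S); apply/eqP.
suff -> : \max_(K : {set G} | twin_free_clique K) #|K| = #|~: S|.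
  by rewrite addnK.
apply/eqP; rewrite eqn_leq; apply/andP; split; last first.
  rewrite resE in resS.
  exact: (leq_bigmax_cond (F := fun K : {set G} => #|K|) _ resS).
apply/bigmax_leqP => K tfK; rewrite -(leq_add2l #|S|) cardsC.
have /minS leS : strong_resolving_set (~: K) by rewrite resE setCK.
by rewrite -(cardsC K) addnC leq_add2l.
Qed.
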